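(* Let $PR=\mathcal K(\mathbf L)$ be the Patras–Reutenauer Hopf algebra. For $\alpha\in\mathbf l[n]$, $$S(\alpha)=\sum_{\gamma\in\mathbf l[n]}(-1)^m\,d_{\alpha,\gamma}\,\gamma,$$ where $m=\ell(\epsilon\vee\gamma)$ and $d_{\alpha,\gamma}$ is the number of $\beta\in\mathbf l[n]$ such that, for $\Lambda=(\Lambda_1,\dots,\Lambda_m)=\beta\vee(\beta\circ\gamma)$: (i) $\beta$ is increasing with respect to $\epsilon$ within each part of $\Lambda$; (ii) $\beta\circ\gamma$ is increasing with respect to $\alpha$ within each part of $\Lambda$; (iii) for all $1\le i<m$, $\max_\epsilon(\Lambda_i)>_\epsilon\min_\epsilon(\Lambda_{i+1})$ or $\max_\alpha(\Lambda_i)>_\alpha\min_\alpha(\Lambda_{i+1})$.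
   Context: $\mathbf l[n]$ is the set of linear orders (words) $\beta=\beta_1\cdots\beta_n$ on $[n]=\{1,\dots,n\}$; $\epsilon=12\cdots n$. $PR=\bigoplus_{n\ge0}\Bbbk\,\mathbf l[n]$ is the graded Hopf algebra (over a field of characteristic $0$) with product $\alpha\cdot\alpha'=$ concatenation of $\alpha\in\mathbf l[n]$ with $\alpha'\in\mathbf l[n']$ shifted by $n$, and coproduct $\Delta(\alpha)=\sum_{S\subseteq[n]}\mathrm{st}(\alpha|_S)\otimes\mathrm{st}(\alpha|_{[n]\setminus S})$, where $\alpha|_S$ is the subword on $S$ and $\mathrm{st}$ relabels order-preservingly onto $\{1,\dots,|S|\}$; $S$ is its antipode. A word $\beta$ is also the permutation $i\mapsto\beta_i$, so $\beta\circ\gamma=\beta(\gamma_1)\cdots\beta(\gamma_n)$; a word $\beta$ is also identified with the set composition $(\{\beta_1\},\dots,\{\beta_n\})$ of $[n]$. A set composition $A=(A_1,\dots,A_k)$ is a sequence of nonempty disjoint sets with union $[n]$, $\ell(A)=k$; $A\le B$ if each part of $B$ is a union of consecutive parts of $A$. For words $\beta,\delta$, $\beta\vee\delta$ is the finest set composition $A$ with $\beta\le A$ and $\delta\le A$. ''$\beta$ increasing with respect to $\epsilon$ within a part $P$'' means the entries of $P$ appear in $\beta$ in increasing numerical order; ''$\beta\circ\gamma$ increasing with respect to $\alpha$ within $P$'' means the entries of $P$ appear in $\beta\circ\gamma$ in the same relative order as in $\alpha$. $<_\epsilon$ is the usual order and $<_\alpha$ is the order in which elements appear in the word $\alpha$;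 $\max_\epsilon,\min_\epsilon,\max_\alpha,\min_\alpha$ are the extremes with respect to these orders. *)

(* Defs.v *)
From HB Require Import structures.
From mathcomp Require Import all_boot all_order all_algebra all_fingroup.
From mathcomp Require Import finmap.
From mathcomp.multinomials Require Import monalg.

Set Implicit Arguments.
Unset Strict Implicit.
Unset Printing Implicit Defensive.

Import GRing.Theory.

(* The set [n] is 'I_n = {0, ..., n-1}.  A word b = b_1 ... b_n of l[n] is the
   permutation b : 'S_n sending a position to the letter found there; b^-1 sends
   a letter to its position. *)

Section Words.

Definition eps n : 'S_n := 1%g.

(* Products in 'S_n are composed left to right: (s * t) i = t (s i). *)
Definition wcomp n (b c : 'S_n) : 'S_n := (c * b)%g.

Lemma wcompE n (b c : 'S_n) i : wcomp b c i = b (c i).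
Proof. exact: permM. Qed.

Definition letters n (a : 'S_n) : seq 'I_n := [seq a i | i <- enum 'I_n].

Lemma mem_letters n (a : 'S_n) x : x \in letters a.
Proof. by apply/mapP; exists (a^-1 x)%g; rewrite ?mem_enum ?permKV. Qed.

Lemma letters_uniq n (a : 'S_n) : uniq (letters a).
Proof. by rewrite map_inj_uniq ?enum_uniq //; apply: perm_inj. Qed.

Lemma size_letters n (a : 'S_n) : size (letters a) = n.
Proof. by rewrite size_map size_enum_ord. Qed.

Definition cat_fun m n (a : 'S_m) (b : 'S_n) (i : 'I_(m + n)) : 'I_(m + n) :=
  match split i with
  | inl j => lshift n (a j)
  | inr k => rshift m (b k)
  end.

Lemma cat_fun_inj m n (a : 'S_m) (b : 'S_n) : injective (cat_fun a b).
Proof.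
move=> i j; rewrite /cat_fun.
case: (split_ordP i) => i' ->; case: (split_ordP j) => j' -> /eqP;
  by rewrite eq_shift // => /eqP/perm_inj ->.
Qed.

Definition wcat m n (a : 'S_m) (b : 'S_n) : 'S_(m + n) :=
  perm (@cat_fun_inj m n a b).

Definition subword n (a : 'S_n) (P : {set 'I_n}) : seq 'I_n :=
  [seq x <- letters a | x \in P].

Lemma size_subword n (a : 'S_n) (P : {set 'I_n}) : size (subword a P) == #|P|.
Proof.
rewrite cardE; apply/eqP/perm_size/uniq_perm.
- by rewrite filter_uniq ?letters_uniq.
- exact: enum_uniq.
by move=> x; rewrite mem_filter mem_letters mem_enum andbT.
Qed.

Definition subword_tuple n (a : 'S_n) (P : {set 'I_n}) : #|P|.-tuple 'I_n :=
  Tuple (size_subword a P).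

Lemma mem_subword_tuple n (a : 'S_n) (P : {set 'I_n}) i :
  tnth (subword_tuple a P) i \in P.
Proof. by have := mem_tnth i (subword_tuple a P); rewrite mem_filter => /andP[]. Qed.

(* enum P lists P increasingly, so enum_rank_in is the order-preserving
   relabelling of P onto {0, ..., #|P| - 1}. *)
Definition st_fun n (a : 'S_n) (P : {set 'I_n}) (i : 'I_#|P|) : 'I_#|P| :=
  enum_rank_in (mem_subword_tuple a i) (tnth (subword_tuple a P) i).

Lemma st_fun_inj n (a : 'S_n) (P : {set 'I_n}) : injective (st_fun a (P := P)).
Proof.
move=> i j /(congr1 enum_val); rewrite !enum_rankK_in ?mem_subword_tuple //.
by apply/tuple_uniqP/filter_uniq/letters_uniq.
Qed.

(* st (a|_P) *)
Definition st n (a : 'S_n) (P : {set 'I_n}) : 'S_#|P| :=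
  perm (@st_fun_inj n a P).

End Words.

Section SetCompositions.
Variable n : nat.

Definition is_setcomp (A : seq {set 'I_n}) :=
  uniq A && partition [set P in A] [set: 'I_n].

(* The bound on the number of parts is no restriction (the parts are nonempty
   and disjoint); it makes setcomp a finType. *)
Record setcomp := SetComp {
  parts :> n.-bseq {set 'I_n};
  _ : is_setcomp parts
}.

HB.instance Definition _ := [isSub for parts].
HB.instance Definition _ := [Finite of setcomp by <:].

(* A <= B: B is obtained by cutting the sequence A into consecutive runs, of
   lengths sh, and taking the union of each run, in the same order. *)
Definition refines (A B : setcomp) :=
  [exists sh : (size B).-tuple 'I_n.+1,
     (sumn (map val sh) == size A) &&
     (parts B == [seq \bigcup_(P <- run) P | run <- reshape (map val sh) A]
        :> seq {set 'I_n})].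

Definition is_join (A B C : setcomp) :=
  [&& refines A C, refines B C &
      [forall D, refines A D ==> refines B D ==> refines C D]].

Lemma wparts_subproof (b : 'S_n) : (size [seq [set x] | x <- letters b] <= n)%N.
Proof. by rewrite size_map size_letters. Qed.

Definition wparts (b : 'S_n) : n.-bseq {set 'I_n} := Bseq (wparts_subproof b).

Lemma is_setcomp_wparts b : is_setcomp (wparts b).
Proof.
rewrite /is_setcomp map_inj_uniq ?letters_uniq /=; last exact: set1_inj.
apply/and3P; split.
- rewrite eqEsubset subsetT; apply/subsetP => x _; apply/bigcupP.
  by exists [set x]; rewrite ?inE // map_f ?mem_letters.
- apply/trivIsetP => P Q; rewrite !inE => /mapP[x _ ->] /mapP[y _ ->] xy.
  by rewrite disjoints1 inE; apply: contraNN xy => /eqP ->.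
- by rewrite inE; apply/mapP => -[x _ /setP/(_ x)]; rewrite !inE eqxx.
Qed.

Definition of_word (b : 'S_n) : setcomp := SetComp (is_setcomp_wparts b).

(* The default value is never used, see wjoinP. *)
Definition wjoin (b d : 'S_n) : setcomp :=
  odflt (of_word b) [pick A | is_join (of_word b) (of_word d) A].

Definition lt_wrt (s : 'S_n) (x y : 'I_n) := ((s^-1)%g x < (s^-1)%g y)%N.

Definition increasing_within (b s : 'S_n) (P : {set 'I_n}) :=
  [forall i : 'I_n, forall j : 'I_n,
     [&& (i < j)%N, b i \in P & b j \in P] ==> lt_wrt s (b i) (b j)].

Definition is_max (s : 'S_n) (P : {set 'I_n}) x :=
  (x \in P) && [forall y in P, ~~ lt_wrt s x y].

Definition is_min (s : 'S_n) (P : {set 'I_n}) x :=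
  (x \in P) && [forall y in P, ~~ lt_wrt s y x].

(* max_s(P) >_s min_s(Q) *)
Definition max_gt_min (s : 'S_n) (P Q : {set 'I_n}) :=
  [exists x, exists y, [&& is_max s P x, is_min s Q y & lt_wrt s y x]].

Definition d_cond (a c b : 'S_n) :=
  let L := wjoin b (wcomp b c) in
  [&& all (increasing_within b (eps n)) L,
      all (increasing_within (wcomp b c) a) L &
      [forall i : 'I_n, (i.+1 < size L)%N ==>
         (max_gt_min (eps n) (nth set0 L i) (nth set0 L i.+1) ||
          max_gt_min a (nth set0 L i) (nth set0 L i.+1))]].

Definition d_coef (a c : 'S_n) : nat := #|[set b : 'S_n | d_cond a c b]|.

End SetCompositions.

Local Open Scope ring_scope.

Section PatrasReutenauer.

Definition lorder := {n : nat & 'S_n}.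

HB.instance Definition _ := Choice.on lorder.

Definition lo n (a : 'S_n) : lorder := Tagged (fun k => 'S_k) a.

Definition lo_one : lorder := lo (eps 0).

Definition lo_mul (u v : lorder) : lorder := lo (wcat (tagged u) (tagged v)).

Definition lo_seq (u : lorder) : seq nat := map val (letters (tagged u)).

Lemma size_lo_seq u : size (lo_seq u) = tag u.
Proof. by rewrite size_map size_letters. Qed.

Lemma lo_seq_inj : injective lo_seq.
Proof.
move=> u v e; have := congr1 size e; rewrite !size_lo_seq.
case: u v e => [m a] [n b] /= e mn; case: n / mn b e => b.
move/(inj_map val_inj) => e; congr existT; apply/permP => i.
by have/eq_in_map/(_ i) := e; apply; rewrite mem_enum.
Qed.

Lemma enum_ord_add m n : enum 'I_(m + n) =
  map (lshift n) (enum 'I_m) ++ map (@rshift m n) (enum 'I_n).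
Proof.
apply: (inj_map val_inj); rewrite val_enum_ord map_cat iotaD add0n.
congr (_ ++ _); rewrite -map_comp; first by rewrite -val_enum_ord; apply: eq_map.
by rewrite -{1}[m]addn0 iotaDl -val_enum_ord -map_comp; apply: eq_map.
Qed.

Lemma lo_seq_mul u v :
  lo_seq (lo_mul u v) = lo_seq u ++ [seq (tag u + x)%N | x <- lo_seq v].
Proof.
case: u v => [m a] [n b].
rewrite /lo_seq /= /letters enum_ord_add !map_cat -!(map_comp (wcat a b)).
rewrite -!(map_comp val) -(map_comp (addn m)).
congr (_ ++ _); apply: eq_map => i /=; rewrite permE /cat_fun.
- by rewrite -[lshift n i]/(unsplit (inl i)) unsplitK.
- by rewrite -[rshift m i]/(unsplit (inr i)) unsplitK.
Qed.

Lemma lo_mulA : associative lo_mul.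
Proof.
move=> u v w; apply: lo_seq_inj; rewrite !lo_seq_mul map_cat catA -!map_comp.
by congr (_ ++ _); apply: eq_map => x /=; rewrite addnA.
Qed.

Lemma lo_seq_one : lo_seq lo_one = [::].
Proof. by apply: size0nil; rewrite size_lo_seq. Qed.

Lemma lo_mul1 : left_id lo_one lo_mul.
Proof.
by move=> u; apply: lo_seq_inj; rewrite lo_seq_mul lo_seq_one map_id.
Qed.

Lemma lo_mulr1 : right_id lo_one lo_mul.
Proof. by move=> u; apply: lo_seq_inj; rewrite lo_seq_mul lo_seq_one cats0. Qed.

Lemma lo_unit u v : lo_mul u v = lo_one -> u = lo_one /\ v = lo_one.
Proof.
move/(congr1 lo_seq); rewrite lo_seq_mul lo_seq_one.
case eu: (lo_seq u) => //; case ev: (lo_seq v) => // _.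
by split; apply: lo_seq_inj; rewrite lo_seq_one.
Qed.

(* With this monoid structure on its basis, {malg k[lorder]} is canonically a
   k-algebra, whose product is the shifted concatenation. *)
HB.instance Definition _ := Choice_isMonomialDef.Build lorder
  lo_mulA lo_mul1 lo_mulr1 lo_unit.

Variable k : fieldType.

Definition PR : Type := {malg k[lorder]}.

HB.instance Definition _ := GRing.Lalgebra.on PR.

(* PR (x) PR, with basis the pairs u (x) v of basis elements. *)
Definition PR2 : Type := {malg k[(lorder * lorder)%type]}.

HB.instance Definition _ := GRing.Lmodule.on PR2.

Definition bas n (a : 'S_n) : PR := << lo a >>.

Definition lin_ext (I : choiceType) (V : lmodType k) (f : I -> V)
    (x : {malg k[I]}) : V :=
  \sum_(u <- msupp x) x@_u *: f u.

Definition coprod : PR -> PR2 :=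
  lin_ext (fun u : lorder =>
    \sum_(P : {set 'I_(tag u)})
       (<< (lo (st (tagged u) P), lo (st (tagged u) (~: P))) >> : PR2)).

Definition counit (x : PR) : k := x@_lo_one.

(* mu \o (f (x) g) \o Delta, for linear f and g *)
Definition convolution (f g : PR -> PR) (x : PR) : PR :=
  lin_ext (fun uv : lorder * lorder => f << uv.1 >> * g << uv.2 >>) (coprod x).

Definition is_antipode (S : {linear PR -> PR}) : Prop :=
  forall x, convolution S id x = (counit x)%:A /\
            convolution id S x = (counit x)%:A.

End PatrasReutenauer.

(* The join of two words exists. *)

Local Open Scope nat_scope.

Section JoinExists.
Variable T : finType.
Implicit Types (b d l : seq T) (A B : seq {set T}).

Definition coarsening b A :=
  exists2 bb, flatten bb = b & A = [seq [set x in l] | l <- bb].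

Lemma least_coarsening b d : uniq b -> perm_eq b d -> exists A,
  [/\ set0 \notin A, coarsening b A, coarsening d A &
      forall B, set0 \notin B -> coarsening b B -> coarsening d B ->
        exists2 ss, flatten ss = A & B = [seq \bigcup_(P <- s) P | s <- ss]].
Proof.
have [N] := ubnP (size b); elim: N => // N IHN in b d *; rewrite ltnS => leN ub bd.
have [b0|b_gt0] := posnP (size b).
  have d0 : d = [::] by apply: size0nil; rewrite -(perm_size bd).
  exists [::]; split=> //; [by exists [::]; rewrite // (size0nil b0)|by exists [::]|].
  move=> B B0 [[|l bb] /= eb eB] _; first by exists [::]; rewrite // eB.
  move: eb; rewrite (size0nil b0); case: l eB => // eB.
  by move: B0; rewrite eB inE negb_or => /andP[/eqP[]]; apply/setP=> x; rewrite !inE.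
have ud : uniq d by rewrite -(perm_uniq bd).
have ex : exists k, (0 < k) && perm_eq (take k b) (take k d).
  by exists (size b); rewrite b_gt0 take_size (perm_size bd) take_size.
case: (ex_minnP ex) => k /andP[k_gt0 bdk] min_k.
have bdk' : perm_eq (drop k b) (drop k d).
  rewrite -(perm_cat2l (take k b)) cat_take_drop; apply: perm_trans bd _.
  by rewrite -{1}(cat_take_drop k d) perm_cat2r perm_sym.
have lek : k <= size b.
  by apply: min_k; rewrite b_gt0 take_size (perm_size bd) take_size.
have [|A' [A'0 [bb' ebb' eA'] [dd' edd' eA''] minA']] := IHN _ (drop k d) _ (drop_uniq k ub) bdk'.
  by rewrite size_drop; apply: leq_trans leN; rewrite ltn_subrL k_gt0.
pose K := [set x in take k b].
have KE : K = [set x in take k d] by apply/setP=> x; rewrite !inE (perm_mem bdk).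
have Kn0 : K != set0.
  apply/set0Pn; rewrite /K; case: (b) b_gt0 => // x s _.
  by case: (k) k_gt0 => // m _; exists x; rewrite !inE eqxx.
exists (K :: A'); split.
- by rewrite inE negb_or eq_sym Kn0.
- by exists (take k b :: bb'); rewrite /= ?ebb' ?cat_take_drop // eA'.
- by exists (take k d :: dd'); rewrite /= ?edd' ?cat_take_drop // KE eA''.
move=> B B0 [[|l bb] /= eb eB] [[|l' dd] /= ed eB'].
- by rewrite -eb in b_gt0.
- by rewrite -eb in b_gt0.
- by rewrite eB in eB'.
rewrite eB in eB'; case: eB' => ell eB'.
have ul : uniq l by move: ub; rewrite -eb cat_uniq => /and3P[].
have ul' : uniq l' by move: ud; rewrite -ed cat_uniq => /and3P[].
have pl : perm_eq l l'.
  by apply: uniq_perm => // x; have /setP/(_ x) := ell; rewrite !inE.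
have l_gt0 : 0 < size l.
  rewrite lt0n; apply: contraNneq B0 => /size0nil l0.
  by rewrite eB l0 inE; apply/orP; left; apply/eqP/setP=> x; rewrite !inE.
have lekl : k <= size l.
  apply: min_k; rewrite l_gt0 -{1}eb take_size_cat //.
  by rewrite -ed take_size_cat // (perm_size pl).
have tkb : take k b = take k l by rewrite -eb takel_cat.
have tkd : take k d = take k l' by rewrite -ed takel_cat // -(perm_size pl).
have dkb : drop k b = drop k l ++ flatten bb.
  rewrite -eb drop_cat; case: ltnP => // le'; have -> : k = size l by apply/eqP; rewrite eqn_leq lekl.
  by rewrite subnn drop0 drop_size.
have dkd : drop k d = drop k l' ++ flatten dd.
  rewrite -ed drop_cat -(perm_size pl); case: ltnP => // le'.
  have -> : k = size l' by apply/eqP; rewrite eqn_leq -(perm_size pl) lekl.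
  by rewrite (perm_size pl) subnn drop0 drop_size.
have B'0 : set0 \notin [seq [set x in l] | l <- bb].
  by apply: contraNN B0; rewrite eB inE orbC => ->.
have pdl : drop k l =i drop k l'.
  have : perm_eq (take k l ++ drop k l) (take k l' ++ drop k l').
    by rewrite !cat_take_drop.
  rewrite -tkb -tkd => h; apply: perm_mem.
  by rewrite -(perm_cat2l (take k b)); apply: perm_trans h _; rewrite perm_cat2r perm_sym.
have [dl0|dln0] := eqVneq (drop k l) [::].
  have dl'0 : drop k l' = [::].
    by apply: size0nil; rewrite size_drop -(perm_size pl) -size_drop dl0.
  have [|||ss ess eBss] := minA' [seq [set x in l] | l <- bb] => //.
  - by exists bb; rewrite ?dkb ?dl0.
  - by exists dd; rewrite ?dkd ?dl'0.
  exists ([:: K] :: ss); rewrite /= ?ess // eB -eBss; congr (_ :: _).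
  by rewrite big_seq1 /K tkb -{1}(cat_take_drop k l) dl0 cats0.
have [|||[|s ss] ess eBss] := minA' ([set x in drop k l] :: [seq [set x in l] | l <- bb]).
- rewrite inE negb_or B'0 andbT eq_sym; apply/set0Pn.
  by case: (drop k l) dln0 => // x s _; exists x; rewrite !inE eqxx.
- by exists (drop k l :: bb); rewrite /= ?dkb.
- exists (drop k l' :: dd); rewrite /= ?dkd // eB'; congr (_ :: _).
  by apply/setP=> x; rewrite !inE pdl.
- by [].
case: eBss => es eBss; exists ((K :: s) :: ss); rewrite /= -?ess // eB eBss.
congr (_ :: _); rewrite big_cons -es; apply/setP=> x.
by rewrite !inE tkb -{1}(cat_take_drop k l) mem_cat.
Qed.

Lemma coarsening_disjoint b A : uniq b -> set0 \notin A -> coarsening b A ->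
  [/\ uniq A, size A <= size b, trivIset [set P in A]
    & forall x, x \in b -> exists2 P, P \in A & x \in P].
Proof.
move=> ub A0 [bb eb eA]; elim: bb => [|l bb IHbb] /= in b A ub A0 eb eA *.
  rewrite -eb eA; split=> //; apply/trivIsetP => P Q; by rewrite !inE.
move: ub A0; rewrite -eb eA cat_uniq inE negb_or => /and3P[ul dis ubb] /andP[l0 A0].
have [uA szA /trivIsetP tA cA] := IHbb _ _ ubb A0 erefl erefl.
have disP P : P \in [seq [set x in l] | l <- bb] -> [disjoint [set x in l] & P].
  case/mapP=> l' l'bb ->; rewrite -setI_eq0; apply/eqP/setP=> x; rewrite !inE.
  apply/negP=> /andP[xl xl']; case/hasP: dis; exists x => //.
  by apply/flattenP; exists l'.
split.
- rewrite /= uA andbT; apply: contraNN l0 => /disP.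
  by rewrite -setI_eq0 setIid eq_sym.
- rewrite /= size_cat -add1n leq_add // lt0n; apply: contraNneq l0 => /size0nil ->.
  by apply/eqP/setP=> x; rewrite !inE.
- apply/trivIsetP => P Q; rewrite !inE.
  case/orP=> [/eqP->|PA] /orP[/eqP->|QA]; rewrite ?eqxx // => PQ.
  + exact: disP.
  + by rewrite disjoint_sym; apply: disP.
  + by apply: tA; rewrite ?inE.
- move=> x; rewrite mem_cat => /orP[xl|/cA[P PA xP]].
    by exists [set x in l]; rewrite ?inE ?eqxx ?xl.
  by exists P; rewrite // inE PA orbT.
Qed.

End JoinExists.

Section JoinCorrect.
Variable n : nat.
Implicit Types (A B C : setcomp n) (b d : 'S_n).

Lemma refinesP A B : reflect
  (exists2 ss, flatten ss = A & parts B = [seq \bigcup_(P <- s) P | s <- ss] :> seq _)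
  (refines A B).
Proof.
apply: (iffP existsP) => [[sh /andP[/eqP szA /eqP eB]]|[ss eA eB]].
  by exists (reshape (map val sh) A) => //; rewrite reshapeKr ?szA.
have sz : size (map (@inord n) (shape ss)) == size B.
  by rewrite eB !size_map.
exists (Tuple sz).
have -> : map val (Tuple sz) = shape ss.
  rewrite /= -map_comp -[RHS]map_id; apply/eq_in_map => i iss /=; rewrite inordK //.
  rewrite ltnS; apply: leq_trans (size_bseq A); rewrite -eA size_flatten.
  elim: (shape ss) iss => //= j s IHs; rewrite inE => /predU1P[->|/IHs le_i].
    exact: leq_addr.
  exact: leq_trans le_i (leq_addl _ _).
by rewrite -size_flatten -eA flattenK eB !eqxx.
Qed.

Lemma refines_wordP b (B : setcomp n) :
  reflect (coarsening (letters b) B) (refines (of_word b) B).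
Proof.
have U (l : seq 'I_n) : \bigcup_(P <- map set1 l) P = [set x in l].
  by apply/setP=> x; rewrite big_map; elim: l => [|y l IHl];
    rewrite ?big_nil ?big_cons !inE // IHl inE.
apply: (iffP (refinesP _ _)) => [[ss eA eB]|[bb eb eB]].
  exists (reshape (shape ss) (letters b)).
    by rewrite reshapeKr -?size_flatten ?eA /= ?size_map.
  rewrite eB -{1}[ss]flattenK eA /= -map_reshape -map_comp.
  by apply: eq_map => l /=; rewrite U.
exists (map (map set1) bb); first by rewrite -map_flatten eb.
by rewrite eB -map_comp; apply: eq_map => l /=; rewrite U.
Qed.

Lemma setcomp0 (A : setcomp n) : set0 \notin (A : seq {set 'I_n}).
Proof. by case: A => A /= /andP[_ /and3P[_ _]]; rewrite inE. Qed.

Lemma wjoinP b d : is_join (of_word b) (of_word d) (wjoin b d).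
Proof.
rewrite /wjoin; case: pickP => //= noA.
have pbd : perm_eq (letters b) (letters d).
  by apply: uniq_perm; rewrite ?letters_uniq // => x; rewrite !mem_letters.
have [A [A0 bA dA minA]] := least_coarsening (letters_uniq b) pbd.
have [uA szA tA cA] := coarsening_disjoint (letters_uniq b) A0 bA.
rewrite size_letters in szA.
have AP : is_setcomp (Bseq szA).
  rewrite /is_setcomp uA /=; apply/and3P; split=> //; last by rewrite in_set.
  rewrite eqEsubset subsetT; apply/subsetP=> x _.
  have [P PA xP] := cA x (mem_letters b x).
  by apply/bigcupP; exists P; rewrite ?inE.
have := noA (SetComp AP) => /negP[]; apply/and3P; split.
- exact/refines_wordP.
- exact/refines_wordP.
apply/forallP=> D; apply/implyP=> /refines_wordP bD; apply/implyP=> /refines_wordP dD.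
by apply/refinesP; apply: minA => //; apply: setcomp0.
Qed.

End JoinCorrect.

(* PR has an antipode, so that is_antipode is satisfiable. *)

Local Open Scope ring_scope.

Section Antipode.

Lemma enum_val_st n (a : 'S_n) (P : {set 'I_n}) i :
  enum_val (st a P i) = tnth (subword_tuple a P) i.
Proof. by rewrite permE enum_rankK_in ?mem_subword_tuple. Qed.

Lemma letters_st n (a : 'S_n) (P : {set 'I_n}) :
  map enum_val (letters (st a P)) = subword a P.
Proof.
rewrite -map_comp -[RHS]/(tval (subword_tuple a P)).
rewrite -[in RHS](map_tnth_enum (subword_tuple a P)).
by apply: eq_map => i; apply: enum_val_st.
Qed.

Lemma enum_val_mono n (P : {set 'I_n}) (i j : 'I_#|P|) :
  (i < j)%N -> (enum_val i < enum_val j)%N.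
Proof.
move=> ij; have x0 := enum_val i.
have : sorted ltn (map val (enum P)).
  apply: (subseq_sorted ltn_trans (s2 := map val (enum 'I_n))).
    by rewrite map_subseq // enumT /= /enum_mem filter_subseq.
  by rewrite val_enum_ord iota_ltn_sorted.
move/(sorted_ltn_nth ltn_trans 0%N)/(_ i j).
rewrite !inE size_map -cardE !ltn_ord => /(_ isT isT ij).
by rewrite !(nth_map x0) -?cardE ?ltn_ord // !(enum_val_nth x0).
Qed.

Lemma lo_st_eq m n (a : 'S_n) (b : 'S_m) (P : {set 'I_n}) (f : 'I_m -> 'I_n) :
  (forall i j : 'I_m, (i < j)%N -> (f i < f j)%N) ->
  map f (letters b) = subword a P -> lo b = lo (st a P).
Proof.
move=> f_mono fb.
have f_inj : injective f.
  move=> i j fij; apply: val_inj => /=; case: (ltngtP i j) => // /f_mono;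
    by rewrite fij ltnn.
have eP : map f (enum 'I_m) = enum P.
  apply: (inj_map val_inj); apply: (irr_sorted_eq ltn_trans ltnn).
  - rewrite -map_comp; have := iota_ltn_sorted 0 m; rewrite -val_enum_ord.
    rewrite !sorted_map; apply: sub_sorted => i j /=; exact: f_mono.
  - apply: (subseq_sorted ltn_trans (s2 := map val (enum 'I_n))).
      by rewrite map_subseq // enumT /= /enum_mem filter_subseq.
    by rewrite val_enum_ord iota_ltn_sorted.
  have memP x : (x \in map f (enum 'I_m)) = (x \in enum P).
    have -> : (x \in enum P) = (x \in subword a P).
      by rewrite mem_enum mem_filter mem_letters andbT.
    rewrite -fb; apply/mapP/mapP => -[y _ ->].
      by exists y; rewrite ?mem_letters.
    by exists y; rewrite ?mem_enum.
  exact: eq_mem_map.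
have em : m = #|P| by rewrite cardE -eP size_map size_enum_ord.
apply: lo_seq_inj; rewrite /lo_seq /=.
have idx (i : 'I_#|P|) : val i = index (enum_val i) (enum P).
  by rewrite (enum_val_nth (enum_val i)) index_uniq ?enum_uniq // -cardE.
rewrite (eq_map idx) (map_comp (fun x => index x (enum P)) enum_val) letters_st -fb.
rewrite -[RHS](map_comp _ f); apply: eq_map => i /=.
by rewrite -eP index_map // index_enum_ord.
Qed.

Lemma lo_st_setT n (a : 'S_n) : lo (st a setT) = lo a.
Proof.
apply/esym/(@lo_st_eq _ _ _ _ _ id) => //.
by rewrite map_id /subword (eq_filter (a2 := predT)) ?filter_predT // => x; rewrite inE.
Qed.

Lemma lo_st0 n (a : 'S_n) (P : {set 'I_n}) : #|P| = 0%N -> lo (st a P) = lo_one.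
Proof. by move=> P0; apply: lo_seq_inj; rewrite lo_seq_one; apply: size0nil; rewrite size_lo_seq. Qed.

Lemma lo_st_st n (a : 'S_n) (P : {set 'I_n}) (Q : {set 'I_#|P|}) :
  lo (st (st a P) Q) = lo (st a (enum_val @: Q)).
Proof.
apply: (lo_st_eq (f := enum_val \o enum_val)).
  by move=> i j ij /=; do 2!apply: enum_val_mono.
rewrite map_comp letters_st /subword.
have e (x : 'I_#|P|) : (x \in Q) = (enum_val x \in enum_val @: Q).
  by rewrite mem_imset //; apply: enum_val_inj.
rewrite (eq_filter e) -filter_map letters_st -filter_predI.
apply: eq_filter => x /=; apply: andb_idr => /imsetP[y _ ->]; exact: enum_valP.
Qed.

Variable k : fieldType.
Implicit Types f g h : lorder -> PR k.

Definition bconv f g (u : lorder) : PR k :=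
  \sum_(P : {set 'I_(tag u)})
     f (lo (st (tagged u) P)) * g (lo (st (tagged u) (~: P))).

Lemma bconv_st f g n (a : 'S_n) (P : {set 'I_n}) :
  bconv f g (lo (st a P)) =
  \sum_(U : {set 'I_n} | U \subset P) f (lo (st a U)) * g (lo (st a (P :\: U))).
Proof.
rewrite /bconv /= (reindex_onto (fun Q : {set 'I_#|P|} => enum_val @: Q)
                                (fun U => enum_val @^-1: U)) /=; last first.
  move=> U /subsetP UP; apply/setP=> x; apply/imsetP/idP.
    by case=> y; rewrite inE => yU ->.
  by move=> xU; exists (enum_rank_in (UP x xU) x); rewrite ?inE enum_rankK_in ?UP.
apply: eq_big => [Q|Q _].
  have -> : enum_val @: Q \subset P.
    by apply/subsetP=> x /imsetP[y _ ->]; apply: enum_valP.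
  apply/esym/eqP/setP=> x; rewrite inE mem_imset //; exact: enum_val_inj.
rewrite !lo_st_st; congr (_ * g (lo (st a _))).
apply/setP=> x; rewrite inE; apply/imsetP/andP.
  case=> y; rewrite inE => yQ ->; split; last exact: enum_valP.
  by rewrite mem_imset //; apply: enum_val_inj.
case=> xQ xP; exists (enum_rank_in xP x); last by rewrite enum_rankK_in.
rewrite inE; apply: contraNN xQ => xQ.
by rewrite -[x](enum_rankK_in xP) // imset_f.
Qed.

Lemma bconvA f g h u : bconv f (bconv g h) u = bconv (bconv f g) h u.
Proof.
case: u => n a; rewrite [LHS]/bconv [RHS]/bconv /=.
under eq_bigr do rewrite bconv_st mulr_sumr.
under [RHS]eq_bigr do rewrite bconv_st mulr_suml.
rewrite [RHS](exchange_big_dep predT) //=; apply: eq_bigr => U _.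
rewrite (reindex_onto (fun P => P :\: U) (fun V => U :|: V)) /=; last first.
  move=> V /subsetP VU; apply/setP=> x; rewrite !inE; have := VU x.
  by rewrite !inE; case: (x \in V); case: (x \in U) => // /(_ isT).
apply: eq_big => [P|P /andP[_ /eqP UP]].
  rewrite setDE subsetIr /=; apply/eqP/idP => [<-|UP]; first exact: subsetUl.
  apply/setP=> x; rewrite !inE; have := subsetP UP x.
  by case: (x \in U) => [/(_ isT)->|_] //=; rewrite andbT.
rewrite mulrA; congr (_ * h (lo (st a _))).
by apply/setP=> x; rewrite -UP !inE; case: (x \in U); case: (x \in P).
Qed.

Definition bunit (u : lorder) : PR k := (tag u == 0%N)%:R.

Lemma bconv1l f u : bconv bunit f u = f u.
Proof.
case: u => n a; rewrite /bconv (bigD1 set0) //= big1 ?addr0.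
  by rewrite /bunit /= cards0 mul1r setC0 lo_st_setT.
by move=> P P0; rewrite /bunit /= cards_eq0 (negPf P0) mul0r.
Qed.

Lemma bconv1r f u : bconv f bunit u = f u.
Proof.
case: u => n a; rewrite /bconv (bigD1 setT) //= big1 ?addr0.
  by rewrite /bunit /= setCT cards0 mulr1 lo_st_setT.
move=> P P0; rewrite /bunit /= cards_eq0 -setCT (inj_eq (@setC_inj _)).
by rewrite (negPf P0) mulr0.
Qed.

Definition bid (u : lorder) : PR k := << u >>.

Fixpoint SL_rec N (u : lorder) : PR k :=
  if tag u == 0%N then 1 else
  if N is N'.+1 then
    - \sum_(P : {set 'I_(tag u)} | P != setT)
        SL_rec N' (lo (st (tagged u) P)) * bid (lo (st (tagged u) (~: P)))
  else 0.

Fixpoint SR_rec N (u : lorder) : PR k :=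
  if tag u == 0%N then 1 else
  if N is N'.+1 then
    - \sum_(P : {set 'I_(tag u)} | P != set0)
        bid (lo (st (tagged u) P)) * SR_rec N' (lo (st (tagged u) (~: P)))
  else 0.

Lemma SL_recE M N u : (tag u <= M)%N -> (tag u <= N)%N -> SL_rec M u = SL_rec N u.
Proof.
have z K v : tag v = 0%N -> SL_rec K v = 1 by case: K => [|K] /eqP v0; rewrite /= ifT.
elim: M N u => [|M IHM] [|N] u.
- by move=> u0 _; rewrite !z //; apply/eqP; rewrite -leqn0.
- by move=> u0 _; rewrite !z //; apply/eqP; rewrite -leqn0.
- by move=> _ u0; rewrite !z //; apply/eqP; rewrite -leqn0.
move=> uM uN; rewrite /=; case: (tag u == 0%N); first by [].
congr (- _); apply: eq_bigr => P PT; congr (_ * _).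
have lt : (#|P| < tag u)%N.
  rewrite -[X in (_ < X)%N]card_ord -cardsT; apply: proper_card.
  by rewrite properT.
by apply: IHM; rewrite /= -ltnS; apply: leq_trans lt _.
Qed.

Lemma SR_recE M N u : (tag u <= M)%N -> (tag u <= N)%N -> SR_rec M u = SR_rec N u.
Proof.
have z K v : tag v = 0%N -> SR_rec K v = 1 by case: K => [|K] /eqP v0; rewrite /= ifT.
elim: M N u => [|M IHM] [|N] u.
- by move=> u0 _; rewrite !z //; apply/eqP; rewrite -leqn0.
- by move=> u0 _; rewrite !z //; apply/eqP; rewrite -leqn0.
- by move=> _ u0; rewrite !z //; apply/eqP; rewrite -leqn0.
move=> uM uN; rewrite /=; case: (tag u == 0%N); first by [].
congr (- _); apply: eq_bigr => P PT; congr (_ * _).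
have lt : (#|~: P| < tag u)%N.
  rewrite -[X in (_ < X)%N]card_ord -cardsT; apply: proper_card.
  by rewrite properT -setC0 (inj_eq (@setC_inj _)).
by apply: IHM; rewrite /= -ltnS; apply: leq_trans lt _.
Qed.

Definition SL u := SL_rec (tag u) u.
Definition SR u := SR_rec (tag u) u.

Lemma bid_one : bid lo_one = 1. Proof. by []. Qed.

Lemma SL_conv u : bconv SL bid u = bunit u.
Proof.
case: u => n a; rewrite /bconv /bunit /= (bigD1 setT) //= lo_st_setT setCT.
rewrite (lo_st0 a (cards0 _)) bid_one mulr1 {1}/SL.
case: n a => [|n] a /=.
  by rewrite big1 ?addr0 // => P /eqP[]; apply/setP=> -[].
apply/eqP; rewrite addrC subr_eq0; apply/eqP/eq_bigr => P PT.
congr (_ * _); apply: SL_recE => //=; rewrite -ltnS -[X in (_ < X)%N]card_ord.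
by rewrite -cardsT proper_card // properT.
Qed.

Lemma SR_conv u : bconv bid SR u = bunit u.
Proof.
case: u => n a; rewrite /bconv /bunit /= (bigD1 set0) //= setC0 lo_st_setT.
rewrite (lo_st0 a (cards0 _)) bid_one mul1r {1}/SR.
case: n a => [|n] a /=.
  by rewrite big1 ?addr0 // => P /eqP[]; apply/setP=> -[].
apply/eqP; rewrite addrC subr_eq0; apply/eqP/eq_bigr => P P0.
congr (_ * _); apply: SR_recE => //=; rewrite -ltnS -[X in (_ < X)%N]card_ord.
by rewrite -cardsT proper_card // properT -setC0 (inj_eq (@setC_inj _)).
Qed.

Lemma eq_bconv f f' g g' : f =1 f' -> g =1 g' -> bconv f g =1 bconv f' g'.
Proof. by move=> ff gg u; apply: eq_bigr => P _; rewrite ff gg. Qed.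

Lemma SLR : SL =1 SR.
Proof.
move=> u; rewrite -[LHS]bconv1r -(eq_bconv (frefl _) SR_conv) bconvA.
by rewrite (eq_bconv SL_conv (frefl _)) bconv1l.
Qed.

Lemma lin_ext_sub (I : choiceType) (V : lmodType k) (F : I -> V)
    (D : {fset I}) (x : {malg k[I]}) :
  (msupp x `<=` D)%fset -> lin_ext F x = \sum_(u <- D) x@_u *: F u.
Proof.
move=> xD; rewrite /lin_ext; apply: big_fset_incl => // u _.
by rewrite -mcoeff_eq0 => /eqP->; rewrite scale0r.
Qed.

Lemma lin_ext_linear (I : choiceType) (V : lmodType k) (F : I -> V) :
  linear (lin_ext F).
Proof.
move=> c x y; pose D := (msupp x `|` msupp y `|` msupp (c *: x + y))%fset.
rewrite !(lin_ext_sub F (D := D)).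
- rewrite scaler_sumr -big_split /=; apply: eq_bigr => u _.
  by rewrite mcoeffD mcoeffZ scalerDl scalerA.
- by rewrite /D -fsetUA (fsubset_trans _ (fsubsetUr _ _)) // fsubsetUl.
- by rewrite /D -fsetUA fsubsetUl.
- by rewrite /D fsubsetUr.
Qed.

HB.instance Definition _ (I : choiceType) (V : lmodType k) (F : I -> V) :=
  GRing.isLinear.Build k {malg k[I]} V _ (lin_ext F) (lin_ext_linear F).

Lemma lin_extU (I : choiceType) (V : lmodType k) (F : I -> V) u :
  lin_ext F << u >> = F u.
Proof.
by rewrite /lin_ext msuppU oner_eq0 big_seq_fset1 mcoeffUU scale1r.
Qed.

Lemma bunitE u : bunit u = (u == lo_one)%:R.
Proof.
rewrite /bunit; congr (nat_of_bool _)%:R; apply/eqP/eqP => [u0|-> //].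
by apply: lo_seq_inj; rewrite lo_seq_one; apply: size0nil; rewrite size_lo_seq.
Qed.

Lemma lin_ext_bunit (x : PR k) : lin_ext bunit x = (counit x)%:A.
Proof.
rewrite (lin_ext_sub _ (D := (lo_one |` msupp x)%fset)) ?fsubsetUr //.
rewrite (big_fsetD1 lo_one) ?fset1U1 //= big_seq big1 ?addr0.
  by rewrite bunitE eqxx.
by move=> u; rewrite in_fsetD1 => /andP[/negPf u1 _]; rewrite bunitE u1 scaler0.
Qed.

Lemma convolutionE (F G : PR k -> PR k) x :
  convolution F G x = lin_ext (bconv (F \o bid) (G \o bid)) x.
Proof.
rewrite /convolution /coprod [X in lin_ext _ X]/lin_ext linear_sum.
apply: eq_bigr => u _; rewrite linearZ /=; congr (_ *: _).
by rewrite linear_sum; apply: eq_bigr => P _; apply: lin_extU.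
Qed.

Lemma antipode_exists : exists S : {linear PR k -> PR k}, is_antipode S.
Proof.
exists (lin_ext SL : {linear PR k -> PR k}) => x; rewrite !convolutionE.
have SE : lin_ext SL \o bid =1 SL by move=> u; apply: lin_extU.
by split; rewrite -lin_ext_bunit; apply: eq_bigr => u _; congr (_ *: _);
  rewrite ?(eq_bconv SE (frefl _)) ?(eq_bconv (frefl _) SE) -?SL_conv //
    (eq_bconv (frefl _) SLR) SR_conv SL_conv.
Qed.

End Antipode.

(* Main.v *)
Require Import Defs.
From HB Require Import structures.
From mathcomp Require Import all_boot all_order all_algebra all_fingroup.
From mathcomp Require Import zify.
From mathcomp.multinomials Require Import monalg.

Set Implicit Arguments.
Unset Strict Implicit.
Unset Printing Implicit Defensive.

Import GRing.Theory.

Local Open Scope ring_scope.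

(* Iterating S(alpha) = - sum_(P != 0) alpha|_P . S(alpha|_(P^c)) writes S(alpha)
   as a sum over set compositions A of (-1)^l(A) times a word gamma.  Encode A by
   the word b listing each part increasingly, the word d listing each part in the
   order of alpha (so that d = b o gamma), and the set C of the positions where
   the parts start.  Given b and d, the possible C are the sets between D and J,
   where D consists of 0, the descents of b and the alpha-descents of d, and J of
   the p such that the first p letters of b and of d form the same set.  The sum
   of (-1)^|C| over them vanishes unless D = J, when it is (-1)^|J|.  Finally, J
   is the set of starts of the parts of b \/ d, so that |J| = l(eps \/ gamma), and
   D = J amounts to (i)-(iii). *)

(** * Signs of cuttings of a pair of words *)

Section CutFactors.
Variable R : pzRingType.
Implicit Types (J D : pred nat).

(** Sum of [(-1)^[p in C]] over the choices allowed at [p]: a cut is forced where [D p] holds and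
    forbidden where [J p] fails. With [J p] alone the two choices cancel; with [D p] alone there is
    no choice. *)
Definition cut_factor J D p : R := if J p == D p then (-1) ^+ J p else 0.

Lemma prod_cut_factorE J D (s : seq nat) :
  \prod_(p <- s) cut_factor J D p =
  if all (fun p => J p == D p) s then (-1) ^+ count J s else 0.
Proof.
elim: s => [|p s IHs]; rewrite ?big_nil // big_cons IHs /cut_factor /=.
case: ifP; rewrite ?mul0r //=; case: ifP; rewrite ?mulr0 // => _ _.
by rewrite exprD.
Qed.

(* Peeling off position l.+1 telescopes the sum over the end p of the first block. *)
Lemma prod_cut_factor J D l N : (l < N)%N -> J N ->
  \prod_(l.+1 <= q < N) cut_factor J D q =
  \sum_(l.+1 <= p < N.+1 | J p && all (predC D) (iota l.+1 (p - l.+1)))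
     (if p == N then 1 else - \prod_(p.+1 <= q < N) cut_factor J D q).
Proof.
move=> + JN; move eM : (N - l)%N => M.
elim: M l eM => [|M IHM] l eM lN; first by lia.
rewrite [RHS]big_mkcond [RHS]big_ltn ?ltnS //= subnn /= andbT.
have [lN'|lN'] := ltnP l.+1 N; last first.
  have eN : N = l.+1 by lia.
  by rewrite -eN JN eqxx !big_geq ?addr0.
rewrite (_ : (l.+1 == N) = false); last by lia.
(* A first block ending beyond [l.+1] requires that [l.+1] is not in [D]; the remaining sum is then
   the induction hypothesis. *)
have -> : \sum_(l.+2 <= p < N.+1) (if J p && all (predC D) (iota l.+1 (p - l.+1))
    then if p == N then 1 else - \prod_(p.+1 <= q < N) cut_factor J D q else 0)
  = (~~ D l.+1)%:R * \prod_(l.+2 <= q < N) cut_factor J D q.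
  rewrite (IHM l.+1) ?[in RHS]big_mkcond ?mulr_sumr; [|lia|by []].
  apply: eq_big_nat => p /andP[lp pN].
  have -> : (p - l.+1 = (p - l.+2).+1)%N by lia.
  rewrite /=; case: (D _); rewrite /= ?andbF ?mul0r ?mul1r //.
rewrite big_ltn // /cut_factor -/(cut_factor J D).
(* In the four cases, the factor at [l.+1] equals [(1 - D) - J]: the term [p = l.+1] contributes
   [-J], the later ones [1 - D]. *)
by case: (J l.+1); case: (D l.+1) => /=;
  rewrite ?expr1 ?expr0 ?mulN1r ?mul1r ?mul0r ?addr0 ?add0r ?addNr.
Qed.

End CutFactors.
Arguments cut_factor : simpl never.

Section WordPairs.
Variables (T : eqType) (r1 r2 : T -> nat).
Implicit Types (b d : seq T).

Definition agree b d : pred nat := fun p => perm_eq (take p b) (take p d).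

(* At p = 0 both inequalities are trivial, so 0 counts as a descent. *)
Definition descent b d : pred nat := fun p =>
  (nth 0 (map r1 b) p <= nth 0 (map r1 b) p.-1)%N ||
  (nth 0 (map r2 d) p <= nth 0 (map r2 d) p.-1)%N.

(** Expanding the product gives the sum of [(-1)^|C|] over all sets [C] that contain the descents
    and consist of agreement positions. *)
Definition cut_sign (R : pzRingType) b d : R :=
  \prod_(0 <= p < size b) cut_factor R (agree b d) (descent b d) p.

Lemma descent0 b d : descent b d 0. Proof. by rewrite /descent leqnn. Qed.

Lemma agree0 b d : agree b d 0. Proof. by rewrite /agree !take0. Qed.

(** Position 0 of a nonempty remainder is always a cut, whether or not [p] was a descent of
    [(b, d)]; this gives the factor -1. Later positions keep their factors, since the common prefix
    content cancels from each agreement. *)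
Lemma cut_sign_drop (R : pzRingType) b d p : size b = size d ->
  (p <= size b)%N -> agree b d p ->
  cut_sign R (drop p b) (drop p d) =
  if p == size b then 1
  else - \prod_(p.+1 <= q < size b) cut_factor R (agree b d) (descent b d) q.
Proof.
move=> sbd pb Jp; rewrite /cut_sign size_drop.
case: eqP => [->|/eqP pN]; first by rewrite subnn big_geq.
rewrite big_ltn; last by lia.
rewrite {1}/cut_factor agree0 descent0 /= expr1 mulN1r; congr (- _).
rewrite -[in RHS](add0n p.+1) -addSnnS [RHS]big_addn.
apply: eq_big_nat => q /andP[q0 qN]; rewrite /cut_factor.
have -> : agree (drop p b) (drop p d) q = agree b d (q + p)%N.
  rewrite (addnC q) /agree !takeD.
  rewrite -(perm_cat2l (take p b)); apply/idP/idP => h; apply: (perm_trans h).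
    by rewrite perm_cat2r.
  by rewrite perm_cat2r perm_sym.
suff -> : descent (drop p b) (drop p d) q = descent b d (q + p)%N by [].
rewrite /descent !map_drop !nth_drop addnC.
by have -> : (p + q.-1 = (q + p).-1)%N by lia.
Qed.

Lemma sorted_take_nth (r : T -> nat) b p : (p <= size b)%N ->
  sorted ltn (map r (take p b)) =
  all (fun q => nth 0 (map r b) q.-1 < nth 0 (map r b) q)%N (iota 1 p.-1).
Proof.
move=> pb; apply/(sortedP 0%N)/allP => [h q|h q].
  rewrite mem_iota => /andP[q0 qp].
  have := h q.-1; rewrite map_take size_takel ?size_map // prednK //.
  by rewrite !nth_take; [apply|..]; lia.
rewrite map_take size_takel ?size_map // => qp.
by rewrite !nth_take; [apply: (h q.+1); rewrite mem_iota; lia|lia|lia].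
Qed.

Lemma all_no_descent b d p : (p <= size b)%N -> (p <= size d)%N ->
  all (predC (descent b d)) (iota 1 p.-1) =
  sorted ltn (map r1 (take p b)) && sorted ltn (map r2 (take p d)).
Proof.
move=> pb pd; rewrite !sorted_take_nth // -all_predI; apply: eq_all => q /=.
by rewrite /descent negb_or -!ltnNge.
Qed.

(* p is the end of the first block of a cutting of (b, d). *)
Lemma cut_sign_rec (R : pzRingType) b d : b != [::] -> perm_eq b d ->
  cut_sign R b d =
  - \sum_(p < (size b).+1 | [&& (0 < p)%N, agree b d p,
        sorted ltn (map r1 (take p b)) & sorted ltn (map r2 (take p d))])
     cut_sign R (drop p b) (drop p d).
Proof.
move=> b0 bd; have sbd := perm_size bd.
have N0 : (0 < size b)%N by case: (b) b0.
rewrite {1}/cut_sign big_ltn // {1}/cut_factor agree0 descent0 /= expr1 mulN1r.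
have JN : agree b d (size b) by rewrite /agree take_size sbd take_size.
rewrite (prod_cut_factor R (descent b d) N0 JN); congr (- _).
rewrite -(big_mkord (fun p => [&& (0 < p)%N, agree b d p,
        sorted ltn (map r1 (take p b)) & sorted ltn (map r2 (take p d))])
     (fun p => cut_sign R (drop p b) (drop p d))).
rewrite [RHS]big_mkcond [RHS]big_ltn //= add0r big_mkcond.
apply: eq_big_nat => p /andP[p0 pN].
rewrite p0 /= subn1 all_no_descent; [|lia|lia].
by case: ifP => //= /andP[Jp _]; rewrite cut_sign_drop //; lia.
Qed.

End WordPairs.

(** * Words of relative positions *)

Section IndexWords.

(** Inverse of [lo_seq], made total to avoid carrying proofs: the default is reached only when [s]
    is not a permutation of [iota 0 (size s)]. *)
Definition word_of (s : seq nat) : lorder :=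
  if [pick a : 'S_(size s) | lo_seq (lo a) == s] is Some a then lo a
  else lo_one.

Lemma lo_seqK u : word_of (lo_seq u) = u.
Proof.
move: {-2}(lo_seq u) (erefl (lo_seq u)) => s es; rewrite /word_of.
case: pickP => [a /eqP e|no]; first by apply: lo_seq_inj; rewrite e es.
case: u es => n a es; have sn : n = size s by rewrite es size_lo_seq.
by subst n; have := no a; rewrite {2}es eqxx.
Qed.

Lemma word_ofK s : perm_eq s (iota 0 (size s)) -> lo_seq (word_of s) = s.
Proof.
move=> ps; suff [u <-] : exists u, lo_seq u = s by rewrite lo_seqK.
have lt (i : 'I_(size s)) : (nth 0 s i < size s)%N.
  by have := mem_nth 0 (ltn_ord i); rewrite (perm_mem ps) mem_iota.
have inj : injective (fun i => Ordinal (lt i)).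
  move=> i j [] /eqP; rewrite nth_uniq // ?(perm_uniq ps) ?iota_uniq //.
  by move/eqP/val_inj.
exists (lo (perm inj)); rewrite /lo_seq /letters /= -map_comp.
apply: (@eq_from_nth _ 0%N); rewrite size_map size_enum_ord // => i ins.
by rewrite (nth_map (Ordinal ins)) ?size_enum_ord //= permE /= nth_enum_ord.
Qed.

(** This is the [gamma] with [d = b o gamma], defined for words on any set of letters because the
    induction for the antipode runs over subsets of the alphabet. *)
Definition index_word (T : eqType) (b d : seq T) : lorder :=
  word_of [seq index x b | x <- d].

Lemma index_wordK (T : eqType) (b d : seq T) : uniq b -> perm_eq b d ->
  lo_seq (index_word b d) = [seq index x b | x <- d].
Proof.
move=> ub bd; apply: word_ofK; rewrite size_map.
apply: (@perm_trans _ [seq index x b | x <- b]).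
  by rewrite perm_map // perm_sym.
rewrite -(perm_size bd); suff -> : map (index^~ b) b = iota 0 (size b) by [].
apply: (@eq_from_nth _ 0%N); rewrite size_map ?size_iota // => i ib.
have x0 : T by case: (b) ib.
by rewrite (nth_map x0) // index_uniq // nth_iota.
Qed.

Lemma lo_seq_st n (a : 'S_n) (P : {set 'I_n}) :
  lo_seq (lo (st a P)) = [seq index x (enum P) | x <- subword a P].
Proof.
have idx (i : 'I_#|P|) : val i = index (enum_val i) (enum P).
  by rewrite (enum_val_nth (enum_val i)) index_uniq ?enum_uniq // -cardE.
by rewrite /lo_seq /= (eq_map idx) (map_comp (index^~ (enum P)) enum_val) letters_st.
Qed.

Lemma mem_subword n (a : 'S_n) (P : {set 'I_n}) x : (x \in subword a P) = (x \in P).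
Proof. by rewrite mem_filter mem_letters andbT. Qed.

Lemma subword_uniq n (a : 'S_n) (P : {set 'I_n}) : uniq (subword a P).
Proof. by rewrite filter_uniq ?letters_uniq. Qed.

Lemma letters_eps n : letters (eps n) = enum 'I_n.
Proof. by rewrite /letters (eq_map (@perm1 _)) map_id. Qed.

Lemma subword_eps n (P : {set 'I_n}) : subword (eps n) P = enum P.
Proof. by rewrite /subword letters_eps [in RHS]/enum_mem -enumT. Qed.

(** In the concatenated word a letter of [P] has its rank in [P] as index, while the indices in [b]
    are shifted by [#|P|], exactly as in the product of [PR]. Thus the first block of a cutting is a
    left factor. *)
Lemma lo_mul_index_word n (a : 'S_n) (P : {set 'I_n}) (b d : seq 'I_n) :
  uniq (enum P ++ b) -> perm_eq b d ->
  lo_mul (lo (st a P)) (index_word b d)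
  = index_word (subword (eps n) P ++ b) (subword a P ++ d).
Proof.
rewrite subword_eps => uPb bd; have := uPb; rewrite cat_uniq => /and3P[_ /hasPn dis ub].
apply: lo_seq_inj; rewrite lo_seq_mul lo_seq_st !index_wordK //; last first.
  apply: perm_cat bd; apply: uniq_perm => [||x]; rewrite ?enum_uniq ?subword_uniq //.
  by rewrite mem_subword mem_enum.
rewrite map_cat -map_comp; congr (_ ++ _); apply/eq_in_map => x xd /=.
  by rewrite index_cat mem_enum -(mem_subword a) xd.
have := dis x; rewrite (perm_mem bd) xd => /(_ isT) /negbTE xP.
by rewrite index_cat xP -cardE.
Qed.

(** Turns the order of appearance in [s] into the order of [nat], so that monotonicity for [eps] and
    for [alpha] both become [sorted ltn]. *)
Definition letter_rank n (s : 'S_n) (x : 'I_n) : nat := (s^-1)%g x.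

Lemma letter_rank_inj n (s : 'S_n) : injective (letter_rank s).
Proof. by move=> x y /val_inj/perm_inj. Qed.

Lemma map_letter_rank n (s : 'S_n) : map (letter_rank s) (letters s) = iota 0 n.
Proof.
rewrite -map_comp -val_enum_ord; apply: eq_map => i.
by rewrite /letter_rank /= permK.
Qed.

Lemma sorted_subword n (s : 'S_n) (P : {set 'I_n}) :
  sorted ltn (map (letter_rank s) (subword s P)).
Proof.
apply: (subseq_sorted ltn_trans (s2 := map (letter_rank s) (letters s))).
  by rewrite map_subseq // filter_subseq.
by rewrite map_letter_rank iota_ltn_sorted.
Qed.

Lemma eq_subword n (s : 'S_n) (P : {set 'I_n}) (w : seq 'I_n) :
  w =i P -> sorted ltn (map (letter_rank s) w) -> w = subword s P.
Proof.
move=> wP srt; apply: (inj_map (@letter_rank_inj n s)).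
apply: (irr_sorted_eq ltn_trans ltnn) => //; first exact: sorted_subword.
by apply: eq_mem_map => x; rewrite mem_subword wP.
Qed.

End IndexWords.

Lemma bid_mulZ (k : fieldType) (c : k) (u v : lorder) :
  bid k u * (c *: bid k v) = c *: bid k (lo_mul u v).
Proof.
have scaleU w : c *: bid k w = (<< c *g w >> : {malg k[lorder]}).
  by apply/malgP => w'; rewrite mcoeffZ !mcoeffU mulrnAr mulr1.
by rewrite !scaleU [LHS]fgmulUU mul1r.
Qed.

(** * The antipode as a signed sum over pairs of words *)

Section Takeuchi.
Variables (k : fieldType) (n : nat) (alpha : 'S_n).
Implicit Types (P Q U : {set 'I_n}) (b d : seq 'I_n).

Definition set_words Q := permutations (enum Q).

Lemma set_wordsP Q b : reflect (uniq b /\ b =i Q) (b \in set_words Q).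
Proof.
rewrite mem_permutations; apply: (iffP idP) => [pb|[ub bQ]].
  by rewrite (perm_uniq pb) enum_uniq; split=> // x; rewrite (perm_mem pb) mem_enum.
by apply: uniq_perm => // [|x]; rewrite ?enum_uniq // bQ mem_enum.
Qed.

Lemma size_set_words Q b : b \in set_words Q -> size b = #|Q|.
Proof. by rewrite mem_permutations => /perm_size ->; rewrite cardE. Qed.

(** Deleting the prefix [w] is a bijection from the words on [Q] that start with [w] to the words on
    the complement of [U] in [Q]. *)
Lemma big_set_words_prefix (V : nmodType) (f : seq 'I_n -> V) (w : seq 'I_n) U Q :
  w \in set_words U -> U \subset Q ->
  \sum_(b <- set_words Q | take #|U| b == w) f b =
  \sum_(b <- set_words (Q :\: U)) f (w ++ b).
Proof.
move=> wU /subsetP UQ; have sw := size_set_words wU.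
have [uw mw] := set_wordsP _ _ wU.
rewrite -big_filter -[RHS](big_map (cat w) predT f); apply: perm_big.
apply: uniq_perm.
- by rewrite filter_uniq ?permutations_uniq.
- rewrite map_inj_uniq ?permutations_uniq // => x y /eqP.
  by rewrite eqseq_cat // => /andP[_ /eqP].
move=> b; rewrite mem_filter; apply/andP/mapP => [[/eqP tb /set_wordsP[ub mb]]|].
  have eb : b = w ++ drop #|U| b by rewrite -tb cat_take_drop.
  exists (drop #|U| b) => //; apply/set_wordsP; split; first exact: drop_uniq.
  move: ub mb; rewrite eb cat_uniq => /and3P[_ /hasPn dis _] mb x.
  rewrite drop_size_cat ?sw // in dis mb *.
  rewrite inE -mw -mb mem_cat.
  case: (boolP (x \in w)) => xw //=; apply/negbTE; apply: contraTN xw; exact: dis.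
case=> b' /set_wordsP[ub' mb'] ->; split; first by rewrite take_size_cat.
apply/set_wordsP; split=> [|x].
  rewrite cat_uniq uw ub' andbT; apply/hasPn => x.
  by rewrite mb' inE mw => /andP[].
rewrite mem_cat mw mb' inE.
by case: (boolP (x \in U)) => //= /UQ ->.
Qed.

Lemma subword_set_words (s : 'S_n) U : subword s U \in set_words U.
Proof. by apply/set_wordsP; split=> [|x]; rewrite ?subword_uniq ?mem_subword. Qed.

Notation sign := (cut_sign (letter_rank (eps n)) (letter_rank alpha) k).

(** This is [cut_sign_rec] indexed by the set [U] of letters of the first block rather than by its
    length. Agreement makes both prefixes words on [U], and sortedness identifies them with the
    restrictions of [eps] and [alpha] to [U]. *)
Lemma cut_sign_subsets Q b d : Q != set0 ->
  b \in set_words Q -> d \in set_words Q ->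
  sign b d = - \sum_(U : {set 'I_n} | [&& U \subset Q, U != set0,
      take #|U| b == subword (eps n) U & take #|U| d == subword alpha U])
    sign (drop #|U| b) (drop #|U| d).
Proof.
move=> Q0 bQ dQ; have [sb sd] := (size_set_words bQ, size_set_words dQ).
have [[ub mb] [ud md]] := (set_wordsP _ _ bQ, set_wordsP _ _ dQ).
rewrite cut_sign_rec; last 2 first.
- by rewrite -size_eq0 sb cards_eq0.
- by apply: uniq_perm => // x; rewrite mb md.
congr (- _); symmetry.
pose pre (p : 'I_(size b).+1) := [set x in take p b].
have cpre (p : 'I_(size b).+1) : #|pre p| = p.
  by rewrite cardsE (card_uniqP (take_uniq _ ub)) size_takel // -ltnS.
rewrite (reindex_onto pre (fun U => inord #|U|)) /=; last first.
  move=> U /and4P[UQ _ /eqP tb _]; apply/setP=> x; rewrite inE inordK ?tb ?mem_subword //.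
  by rewrite ltnS sb subset_leq_card.
apply: eq_big => p; rewrite cpre // inord_val eqxx andbT.
have -> : pre p \subset Q by apply/subsetP=> x; rewrite inE => /mem_take; rewrite mb.
rewrite -cards_eq0 cpre -lt0n /=; congr (_ && _).
apply/andP/and3P => [[/eqP tb /eqP td]|[Jp srt1 srt2]].
  rewrite /agree tb td !sorted_subword; split=> //.
  by apply: uniq_perm => [||x]; rewrite ?subword_uniq // !mem_subword.
split; apply/eqP/eq_subword => // x; rewrite inE //.
by rewrite (perm_mem Jp).
Qed.

(** Strong induction on [#|Q|]. In the convolution of the identity with [S], the term [U = set0] is
    the wanted value; the other terms involve smaller sets, and collecting them by pairs [(b, d)]
    gives the recursion [cut_sign_subsets]. *)
Lemma antipode_st (S : {linear PR k -> PR k}) : is_antipode S -> forall Q,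
  S (bid k (lo (st alpha Q))) =
  \sum_(b <- set_words Q) \sum_(d <- set_words Q)
     sign b d *: bid k (index_word b d).
Proof.
move=> hS; have conv u : bconv (@bid k) (S \o @bid k) u = bunit k u.
  have [_] := hS (bid k u); rewrite convolutionE lin_extU.
  by rewrite -lin_ext_bunit lin_extU => <-.
move=> Q; have [N] := ubnP #|Q|; elim: N Q => // N IHN Q; rewrite ltnS => QN.
have := conv (lo (st alpha Q)); rewrite bconv_st (bigD1 set0) ?sub0set //=.
rewrite (lo_st0 alpha (cards0 _)) bid_one mul1r setD0 /bunit /= cards_eq0.
have [->|Q0] := eqVneq Q set0.
  rewrite big1 ?addr0 => [->|U]; last by rewrite subset0 => /andP[/eqP->]; rewrite eqxx.
  rewrite /set_words enum_set0 /= !big_seq1 /cut_sign big_geq // scale1r.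
  suff -> : index_word (@nil 'I_n) [::] = lo_one by [].
  by apply: lo_seq_inj; rewrite index_wordK ?lo_seq_one.
move/eqP; rewrite addr_eq0 => /eqP ->.
(* Left multiplication by the restriction to [U] prefixes the block of [U] to both words, so the
   product becomes a sum over pairs of words on [Q] with these prefixes. *)
have termE U : (U \subset Q) && (U != set0) ->
    bid k (lo (st alpha U)) * (S \o @bid k) (lo (st alpha (Q :\: U))) =
    \sum_(b <- set_words Q | take #|U| b == subword (eps n) U)
      \sum_(d <- set_words Q | take #|U| d == subword alpha U)
        sign (drop #|U| b) (drop #|U| d) *: bid k (index_word b d).
  case/andP=> UQ U0; rewrite /= IHN; last first.
    apply: leq_trans QN; rewrite cardsD (setIidPr UQ).
    by rewrite ltn_subrL !card_gt0 U0.
  rewrite (big_set_words_prefix _ (subword_set_words _ _)) // mulr_sumr.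
  rewrite !big_seq; apply: eq_bigr => b bW.
  rewrite (big_set_words_prefix _ (subword_set_words _ _)) // mulr_sumr.
  rewrite !big_seq; apply: eq_bigr => d dW.
  rewrite !drop_size_cat ?(size_set_words (subword_set_words _ _)) //.
  have [[ub mb] [ud md]] := (set_wordsP _ _ bW, set_wordsP _ _ dW).
  rewrite -lo_mul_index_word; first last.
  - by apply: uniq_perm => // x; rewrite mb md.
  - rewrite cat_uniq enum_uniq ub andbT; apply/hasPn => x.
    by rewrite mb inE mem_enum => /andP[].
  by rewrite bid_mulZ.
rewrite (eq_bigr _ termE) (exchange_big_dep predT) //= -sumrN.
rewrite !big_seq; apply: eq_bigr => b bW.
rewrite (exchange_big_dep predT) //= -sumrN !big_seq; apply: eq_bigr => d dW.
rewrite (cut_sign_subsets Q0 bW dW) scaleNr scaler_suml; congr (- _).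
by apply: eq_bigl => U; rewrite !andbA.
Qed.

End Takeuchi.

(** * The join of two words *)

Section JoinCuts.
Local Open Scope nat_scope.
Variable n : nat.
Implicit Types (b d s w : 'S_n) (L : seq {set 'I_n}) (c : nat -> nat).

(** The cut positions [c] are a parameter separate from [w], since the two words that are joined
    share them. *)
Definition blocks_at c w L := forall i (x : 'I_n), i < size L ->
  (w x \in nth set0 L i) = (c i <= x < c i.+1).

Lemma index_letters w (x : 'I_n) : index (w x) (letters w) = x.
Proof. by rewrite /letters index_map ?index_enum_ord //; apply: perm_inj. Qed.

Lemma blocks_at_flatten w (bb : seq (seq 'I_n)) : flatten bb = letters w ->
  blocks_at (fun i => sumn (take i (shape bb))) w [seq [set x in l] | l <- bb].
Proof.
move=> eb i x; rewrite size_map => ib.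
rewrite (nth_map [::]) // inE -[in LHS](flattenK bb) nth_reshape eb.
set c := sumn _; have -> : sumn (take i.+1 (shape bb)) = c + nth 0 (shape bb) i.
  by rewrite (take_nth 0) ?size_map // -cats1 sumn_cat /= addn0.
have cD : c + nth 0 (shape bb) i <= n.
  apply: (@leq_trans (sumn (shape bb))); last by rewrite -size_flatten eb size_letters.
  rewrite -[in leqRHS](cat_take_drop i (shape bb)) sumn_cat leq_add2l.
  by rewrite (drop_nth 0) ?size_map //= leq_addr.
have : uniq (letters w) := letters_uniq w.
rewrite -{1}(cat_take_drop c (letters w)) cat_uniq => /and3P[_ /hasPn dis ud].
have ix := index_letters w x; move: ix.
rewrite -{1}(cat_take_drop c (letters w)) index_cat size_takel ?size_letters; last by lia.
(* A letter placed before [c] is outside block [i] by uniqueness; any other letter has index [x - c]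
   in the dropped word, to be compared with the length of the block. *)
have [xc|xc] := boolP (w x \in take c (letters w)).
  have xd : w x \notin drop c (letters w) by apply: contraTN xc => /dis.
  have : w x \notin take (nth 0 (shape bb) i) (drop c (letters w)).
    by apply: contraNN xd => /mem_take.
  move: xc; rewrite in_take ?mem_letters // index_letters => xc /negbTE -> _.
  by lia.
have xd : w x \in drop c (letters w).
  by have := mem_letters w (w x); rewrite -{1}(cat_take_drop c (letters w)) mem_cat (negbTE xc).
by move=> /= ix; rewrite in_take // -ix leq_addr ltn_add2l.
Qed.

Notation agree_words b d := (agree (letters b) (letters d)).

Lemma bigcup_sets_of (bb : seq (seq 'I_n)) :
  \bigcup_(P <- [seq [set x in l] | l <- bb]) P = [set x in flatten bb].
Proof.
apply/setP=> x; rewrite big_map inE; elim: bb => [|l bb IHbb].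
  by rewrite big_nil inE.
by rewrite big_cons !inE IHbb mem_cat.
Qed.

(** Supplies an upper bound of both words whose only interior cut is [p]; minimality of the join
    will then force [p] to be a cut of the join. The strict bounds keep both parts nonempty. *)
Lemma agree_splits b d p : 0 < p < n -> agree_words b d p ->
  exists D : setcomp n, [/\ refines (of_word b) D, refines (of_word d) D
    & parts D = [:: [set x in take p (letters b)]; [set x in drop p (letters b)]] :> seq _].
Proof.
move=> /andP[p0 pn] Jp.
have pbd : perm_eq (letters b) (letters d).
  by apply: uniq_perm; rewrite ?letters_uniq // => x; rewrite !mem_letters.
have Jp' : perm_eq (drop p (letters b)) (drop p (letters d)).
  rewrite -(perm_cat2l (take p (letters b))) cat_take_drop.
  rewrite (perm_trans pbd) // -{1}(cat_take_drop p (letters d)).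
  by rewrite perm_cat2r perm_sym.
pose L := [seq [set x in l] | l <- [:: take p (letters b); drop p (letters b)]].
have bL : coarsening (letters b) L.
  by exists [:: take p (letters b); drop p (letters b)]; rewrite //= cats0 cat_take_drop.
have dL : coarsening (letters d) L.
  exists [:: take p (letters d); drop p (letters d)]; rewrite /= ?cats0 ?cat_take_drop //.
  by congr [:: _; _]; apply/setP=> x; rewrite !inE (perm_mem Jp) || rewrite !inE (perm_mem Jp').
have L0 : set0 \notin L.
  have ne (l : seq 'I_n) : 0 < size l -> set0 != [set x in l].
    case: l => // x l _; rewrite eq_sym; apply/set0Pn; exists x.
    by rewrite !inE eqxx.
  rewrite !inE negb_or !ne // ?size_drop ?size_takel ?size_letters; lia.
have [uL szL tL cL] := coarsening_disjoint (letters_uniq b) L0 bL.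
rewrite size_letters in szL.
have LP : is_setcomp (Bseq szL).
  rewrite /is_setcomp uL /=; apply/and3P; split=> //; last by rewrite in_set.
  rewrite eqEsubset subsetT; apply/subsetP=> x _.
  have [P PA xP] := cL x (mem_letters b x).
  by apply/bigcupP; exists P; rewrite ?in_set.
by exists (SetComp LP); split=> //; apply/refines_wordP.
Qed.

Lemma card_set_of (l : seq 'I_n) : uniq l -> #|[set x in l]| = size l.
Proof. by move=> /card_uniqP <-; rewrite cardsE. Qed.

Lemma uniq_flatten_mem (bb : seq (seq 'I_n)) l : uniq (flatten bb) -> l \in bb -> uniq l.
Proof.
elim: bb => //= l' bb IH; rewrite cat_uniq inE => /and3P[ul' _ ubb].
by case/predU1P => [->|/IH]; [|apply].
Qed.

(** Take for [c i] the total size of the first [i] parts. At a cut, the two prefixes both list the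
    union of these parts; conversely an agreement is a cut by minimality of the join. *)
Lemma wjoin_cuts b d : exists c, [/\ c 0 = 0 /\ c (size (wjoin b d)) = n,
  {in [pred i | i < size (wjoin b d)], forall i, c i < c i.+1},
  blocks_at c b (wjoin b d), blocks_at c d (wjoin b d) &
  forall p, p <= n ->
    agree_words b d p <-> exists2 i, i <= size (wjoin b d) & p = c i].
Proof.
have /and3P[/refines_wordP[bb eb Lb] /refines_wordP[dd ed Ld] /forallP minL] := wjoinP b d.
have L0 := setcomp0 (wjoin b d).
have ub : uniq (flatten bb) by rewrite eb letters_uniq.
have ud : uniq (flatten dd) by rewrite ed letters_uniq.
have shE (ll : seq (seq 'I_n)) : uniq (flatten ll) ->
    shape ll = [seq #|P| | P : {set 'I_n} <- [seq [set x in l] | l <- ll]].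
  move=> ull; rewrite -map_comp; apply/eq_in_map => l lll /=.
  by rewrite card_set_of // (uniq_flatten_mem ull).
(* Block lengths are the cardinals of the parts, hence the same in both words. *)
have sh_bd : shape bb = shape dd by rewrite !shE // -Lb -Ld.
pose c i := sumn (take i (shape bb)).
have sL : size (wjoin b d) = size bb by rewrite Lb size_map.
have cS i : i < size bb -> c i.+1 = c i + nth 0 (shape bb) i.
  by move=> ib; rewrite /c (take_nth 0) ?size_map // -cats1 sumn_cat /= addn0.
exists c; split.
- by rewrite /c take0 sL -(size_map size bb) take_size -size_flatten eb size_letters.
- move=> i; rewrite inE sL => ib; rewrite cS // -addn1 leq_add2l lt0n.
  apply: contraNneq L0 => e; rewrite Lb; apply/(nthP set0); exists i; rewrite ?size_map //.
  rewrite (nth_map [::]) //; move: e; rewrite (nth_map [::]) // => /size0nil ->.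
  by apply/setP=> x; rewrite !inE.
- by rewrite Lb; apply: blocks_at_flatten.
- by rewrite Ld /c sh_bd; apply: blocks_at_flatten.
move=> p pn; split=> [Jp|[i _ ->]]; last first.
  have pre (ll : seq (seq 'I_n)) w : flatten ll = letters w ->
      take (sumn (take i (shape ll))) (letters w) = flatten (take i ll).
    move=> <-; rewrite -{2}(cat_take_drop i ll) flatten_cat /shape -map_take.
    by rewrite -/(shape _) -size_flatten take_size_cat.
  rewrite /agree (pre _ _ eb) /c sh_bd (pre _ _ ed).
  apply: uniq_perm.
  - by move: ub; rewrite -{1}(cat_take_drop i bb) flatten_cat cat_uniq => /and3P[].
  - by move: ud; rewrite -{1}(cat_take_drop i dd) flatten_cat cat_uniq => /and3P[].
  move=> x; have /setP/(_ x) : [set x in flatten (take i bb)] = [set x in flatten (take i dd)].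
    by rewrite -!bigcup_sets_of !map_take -Lb -Ld.
  by rewrite !inE.
have [->|p0] := posnP p; first by exists 0 => //; rewrite /c take0.
have [pn'|pn'] := ltnP p n; last first.
  exists (size (wjoin b d)) => //; rewrite sL /c -(size_map size bb) take_size.
  by rewrite -size_flatten eb size_letters; lia.
have [|D [bD dD eD]] := agree_splits _ Jp; first by rewrite p0.
(* The first part of [D] is the union of an initial run [s1] of parts of the join; comparing
   cardinals gives [p = c (size s1)]. *)
have := minL D; rewrite bD dD => /refinesP[ss ess]; rewrite eD.
case: ss ess => [|s1 [|s2 [|? ?]]] //= ess [eK _].
have s1E : s1 = [seq [set x in l] | l <- take (size s1) bb].
  by rewrite map_take -Lb -ess take_size_cat.
exists (size s1); first by rewrite -ess size_cat leq_addr.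
have := congr1 (fun K : {set 'I_n} => #|K|) eK.
rewrite {1}s1E bigcup_sets_of !card_set_of ?take_uniq ?letters_uniq //; last first.
  by move: ub; rewrite -{1}(cat_take_drop (size s1) bb) flatten_cat cat_uniq => /and3P[].
rewrite size_takel ?size_letters // size_flatten => ->.
by rewrite /c /shape map_take.
Qed.

End JoinCuts.

(** * Conditions on blocks, read at consecutive positions *)

Section Blocks.
Local Open Scope nat_scope.
Variables (n : nat) (L : seq {set 'I_n}) (c : nat -> nat).
Hypothesis cS : {in [pred i | i < size L], forall i, c i < c i.+1}.

Definition is_cut p := exists2 i, i <= size L & p = c i.

Lemma cuts_mono i j : i < j <= size L -> c i < c j.
Proof.
elim: j => // j IHj /andP[ij jL]; have := cS jL.
move: ij; rewrite ltnS leq_eqVlt => /predU1P[->|ij] //; apply: ltn_trans.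
by apply: IHj; rewrite ij ltnW.
Qed.

Lemma cuts_le i j : i <= j <= size L -> c i <= c j.
Proof.
case/andP; rewrite leq_eqVlt => /predU1P[->|ij jL] //.
by rewrite ltnW // cuts_mono // ij.
Qed.

Lemma not_cut_inside i q : i < size L -> c i < q < c i.+1 -> ~ is_cut q.
Proof.
move=> iL /andP[iq qi] [j jL qj]; have [ji|ij] := leqP j i.
  by have := @cuts_le j i; rewrite ji ltnW //= => /(_ isT); lia.
by have := @cuts_le i.+1 j; rewrite ij jL => /(_ isT); lia.
Qed.

Hypothesis cL : c (size L) = n.

Lemma cut_block p : c 0 = 0 -> p < n -> exists2 i, i < size L & c i <= p < c i.+1.
Proof.
move=> c0; rewrite -{1}cL; move: (leqnn (size L)).
elim: {1 3}(size L) => [|m IHm] mL; first by rewrite c0.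
have [pm|pm] := ltnP p (c m); first by move=> _; apply: IHm; rewrite // ltnW.
by exists m; rewrite // pm.
Qed.

(** Each part is counted through its starting position; the last cut [c (size L) = n] falls outside
    [iota 0 n]. *)
Lemma count_cuts (J : pred nat) : (forall p, p <= n -> J p <-> is_cut p) ->
  count J (iota 0 n) = size L.
Proof.
move=> JP; rewrite -size_filter.
transitivity (size (map c (iota 0 (size L)))); last by rewrite size_map size_iota.
apply: perm_size; apply: uniq_perm.
- by rewrite filter_uniq ?iota_uniq.
- rewrite map_inj_in_uniq ?iota_uniq // => i j; rewrite !mem_iota !add0n => /= iL jL e.
  case: (ltngtP i j) => // ij.
    by have := @cuts_mono i j; rewrite ij ltnW // => /(_ isT); lia.
  by have := @cuts_mono j i; rewrite ij ltnW // => /(_ isT); lia.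
move=> p; rewrite mem_filter mem_iota add0n; apply/andP/mapP => [[Jp /= pn]|].
  have [i iL e] := (JP _ (ltnW pn)).1 Jp; exists i => //.
  rewrite mem_iota add0n /= ltn_neqAle iL andbT; apply: contraTneq pn => ei.
  by rewrite e ei cL ltnn.
case=> i; rewrite mem_iota add0n /= => iL ->.
have cin : c i < n by rewrite -[leqRHS]cL cuts_mono // iL leqnn.
by split=> //; apply/(JP _ (ltnW cin)); exists i; rewrite // ltnW.
Qed.

Variables (w s : 'S_n).
Hypothesis wL : blocks_at c w L.

Definition rank_at p := nth 0 (map (letter_rank s) (letters w)) p.

Lemma rank_at_ord (x : 'I_n) : rank_at x = letter_rank s (w x).
Proof.
rewrite /rank_at (nth_map x) ?size_letters // (nth_map x) ?size_enum_ord //.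
by rewrite nth_ord_enum.
Qed.

Lemma increasing_withinP (P : {set 'I_n}) : reflect
  (forall x y : 'I_n, x < y -> w x \in P -> w y \in P -> rank_at x < rank_at y)
  (increasing_within w s P).
Proof.
apply: (iffP forallP) => [h x y xy wx wy|h x].
  by have /forallP/(_ y) := h x; rewrite xy wx wy !rank_at_ord.
apply/forallP => y; apply/implyP => /and3P[xy wx wy].
by have := h x y xy wx wy; rewrite !rank_at_ord.
Qed.

(** Positions [p.-1] and [p] share a block exactly when [p] is not a cut, and inside a block
    increase between neighbours propagates by transitivity. *)
Lemma all_increasing_withinP : c 0 = 0 ->
  all (increasing_within w s) L <->
  (forall p, 0 < p < n -> ~ is_cut p -> rank_at p.-1 < rank_at p).
Proof.
move=> c0; split=> [/(all_nthP set0) incr p /andP[p0 pn] ncut|incr].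
  have [i iL /andP[ip pi]] := cut_block c0 pn.
  have ip' : c i != p by apply/eqP => e; apply: ncut; exists i; rewrite // ltnW.
  have pn' : p.-1 < n by lia.
  have /increasing_withinP/(_ (Ordinal pn') (Ordinal pn)) := incr i iL.
  by rewrite !wL //=; apply; lia.
apply/(all_nthP set0) => i iL; apply/increasing_withinP => x y xy.
rewrite !wL // => /andP[ix _] /andP[_ yi].
have cin : c i.+1 <= n by rewrite -[leqRHS]cL cuts_le // iL leqnn.
have step k : x + k.+1 < c i.+1 -> rank_at x < rank_at (x + k.+1).
  elim: k => [|k IHk] xk.
    have := incr (x + 1); rewrite addn1 /=; apply; first by lia.
    by apply: (not_cut_inside iL); lia.
  apply: ltn_trans (IHk _) _; first by lia.
  have := incr (x + k.+2); rewrite !addnS /=; apply; first by lia.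
  by apply: (not_cut_inside iL); lia.
by have := step (y - x).-1; rewrite (_ : x + _ = y); [apply|lia].
Qed.

Hypothesis incr : all (increasing_within w s) L.

Lemma block_le i (x y : 'I_n) : i < size L ->
  c i <= x -> x <= y -> y < c i.+1 -> letter_rank s (w x) <= letter_rank s (w y).
Proof.
move=> iL ix; rewrite leq_eqVlt => /predU1P[/val_inj-> //|xy yi].
have /increasing_withinP/(_ x y xy) := all_nthP set0 incr i iL.
by rewrite !wL // -!rank_at_ord => h; apply/ltnW/h; lia.
Qed.

(** Since the blocks increase with respect to [s], the maximum of block [i] is its last letter and
    the minimum of block [i.+1] its first; these two letters are adjacent in [w]. *)
Lemma max_gt_min_cut i : i.+1 < size L ->
  max_gt_min s (nth set0 L i) (nth set0 L i.+1) =
  (rank_at (c i.+1) <= rank_at (c i.+1).-1).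
Proof.
move=> iL; have iL' := ltnW iL.
have [ci ci1] := (cS iL', cS iL).
have cin : c i.+2 <= n by rewrite -[leqRHS]cL cuts_le // iL leqnn.
have pn : c i.+1 < n by lia.
have pn' : (c i.+1).-1 < n by lia.
have rx := rank_at_ord (Ordinal pn'); have ry := rank_at_ord (Ordinal pn).
rewrite /= in rx ry; rewrite rx ry; set x := w _ in rx *; set y := w _ in ry *.
have xP : x \in nth set0 L i by rewrite /x wL //=; lia.
have yP : y \in nth set0 L i.+1 by rewrite /y wL //=; lia.
have xmax z : z \in nth set0 L i -> letter_rank s z <= letter_rank s x.
  rewrite -(permKV w z) wL // => /andP[iz zi].
  by apply: (block_le iL') => //=; lia.
have ymin z : z \in nth set0 L i.+1 -> letter_rank s y <= letter_rank s z.
  rewrite -(permKV w z) wL // => /andP[iz zi].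
  by apply: (block_le iL) => //=; lia.
(* Distinct positions carry letters of distinct ranks, so the weak inequality of a descent is
   strict. *)
have xy : letter_rank s y != letter_rank s x.
  rewrite (inj_eq (@letter_rank_inj n s)) (inj_eq (@perm_inj _ w)) -val_eqE /=.
  by lia.
rewrite leq_eqVlt (negbTE xy) /=; apply/existsP/idP => [[x']|yx].
  case/existsP=> y' /and3P[/andP[x'P /forall_inP x'max] /andP[y'P /forall_inP y'min]].
  rewrite /lt_wrt -!/(letter_rank _ _) => y'x'.
  apply: leq_ltn_trans (ymin _ y'P) _; apply: leq_trans y'x' _; exact: xmax.
exists x; apply/existsP; exists y; apply/and3P; split=> //.
- by rewrite /is_max xP; apply/forall_inP => z zP; rewrite /lt_wrt -leqNgt; apply: xmax.
- by rewrite /is_min yP; apply/forall_inP => z zP; rewrite /lt_wrt -leqNgt; apply: ymin.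
Qed.

End Blocks.

(** * Conditions (i)-(iii) as the equality of agreements and descents *)

Section JoinOfWords.
Local Open Scope nat_scope.
Variable n : nat.
Implicit Types a b c d : 'S_n.

Lemma size_wjoin b d :
  size (wjoin b d) = count (agree (letters b) (letters d)) (iota 0 n).
Proof.
have [c [[_ cL] cS _ _ JP]] := wjoin_cuts b d.
by rewrite (count_cuts cS cL JP).
Qed.

(** At 0 both sides hold. At the other positions that are not cuts, the equality amounts to (i) and
    (ii); once the blocks are known to increase, at the remaining cuts it is (iii), by
    [max_gt_min_cut]. *)
Lemma d_condE a c b : d_cond a c b =
  all (fun p => agree (letters b) (letters (wcomp b c)) p ==
     descent (letter_rank (eps n)) (letter_rank a) (letters b) (letters (wcomp b c)) p)
    (iota 0 n).
Proof.
rewrite /d_cond; set d := wcomp b c.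
have [cut [[c0 cL] cS bL dL JP]] := wjoin_cuts b d.
set L := wjoin b d in c0 cL cS bL dL JP *.
have JPP p : p <= n -> reflect (is_cut L cut p) (agree (letters b) (letters d) p).
  by move=> pn; apply: (iffP idP) => /(JP p pn).
have incb := all_increasing_withinP cS cL (eps n) bL c0.
have incd := all_increasing_withinP cS cL a dL c0.
have descE p : descent (letter_rank (eps n)) (letter_rank a) (letters b) (letters d) p =
  (rank_at b (eps n) p <= rank_at b (eps n) p.-1) || (rank_at d a p <= rank_at d a p.-1) by [].
have cin i : i.+1 < size L -> 0 < cut i.+1 < n.
  move=> iL; have := cS i (ltnW iL); have := cuts_mono cS (i := i.+1) (j := size L).
  by rewrite iL leqnn cL => /(_ isT); lia.
apply/and3P/allP => [[ib id /forallP mx] p|JD].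
  rewrite mem_iota add0n => /= pn.
  have [->|p0] := posnP p; first by rewrite agree0 descent0.
  have p0n : 0 < p < n by rewrite p0.
  case: JPP => [|[[|i] iL ep]|ncut]; first exact: ltnW.
  - by rewrite ep c0 in p0.
  - have iL' : i.+1 < size L.
      by rewrite ltn_neqAle iL andbT; apply: contraTneq pn => e; rewrite ep e cL ltnn.
    (* Condition (iii) is quantified over ['I_n], so the index of the part has to be bounded by
       [n]. *)
    have iln : i < n by have := size_bseq L; lia.
    have := mx (Ordinal iln); rewrite iL' /=.
    rewrite (max_gt_min_cut cS cL bL ib iL') (max_gt_min_cut cS cL dL id iL').
    by rewrite -ep descE => ->.
  have /incb/(_ p p0n ncut) h1 := ib; have /incd/(_ p p0n ncut) h2 := id.
  by apply/eqP/esym/negbTE; rewrite descE negb_or -!ltnNge h1 h2.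
have JDp p : 0 < p < n -> agree (letters b) (letters d) p =
    (rank_at b (eps n) p <= rank_at b (eps n) p.-1) || (rank_at d a p <= rank_at d a p.-1).
  by case/andP=> p0 pn; apply/eqP/JD; rewrite mem_iota.
have ib : all (increasing_within b (eps n)) L.
  apply/incb => p pn ncut; have /andP[_ /ltnW pn'] := pn.
  by have := JDp p pn; case: JPP => // _ /esym/negbT; rewrite negb_or -!ltnNge => /andP[].
have id : all (increasing_within d a) L.
  apply/incd => p pn ncut; have /andP[_ /ltnW pn'] := pn.
  by have := JDp p pn; case: JPP => // _ /esym/negbT; rewrite negb_or -!ltnNge => /andP[].
split=> //; apply/forallP => i; apply/implyP => iL.
rewrite (max_gt_min_cut cS cL bL ib iL) (max_gt_min_cut cS cL dL id iL).
rewrite -JDp ?cin //; have /andP[_ /ltnW pn'] := cin i iL.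
by apply/JPP => //; exists i.+1; rewrite // ltnW.
Qed.

Lemma letters_wcomp b c : letters (wcomp b c) = map b (letters c).
Proof. by rewrite /letters -[RHS]map_comp; apply: eq_map => i; rewrite wcompE. Qed.

(** Renaming all letters by the bijection [b] preserves agreement of prefixes. Hence the number of
    parts of the join, and with it the sign, depends on [c] alone. *)
Lemma agree_wcomp b c p :
  agree (letters b) (letters (wcomp b c)) p = agree (letters (eps n)) (letters c) p.
Proof.
have -> : letters b = map b (letters (eps n)) by rewrite letters_eps.
rewrite letters_wcomp /agree -!map_take; apply/idP/idP; last exact: perm_map.
exact/perm_map_inj/perm_inj.
Qed.

Lemma index_word_wcomp b c : index_word (letters b) (letters (wcomp b c)) = lo c.
Proof.
rewrite -[RHS]lo_seqK; congr word_of; rewrite letters_wcomp -map_comp /lo_seq.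
by apply: eq_map => i /=; rewrite index_letters.
Qed.

Lemma set_words_setT : perm_eq (set_words [set: 'I_n]) [seq letters a | a : 'S_n].
Proof.
have letters_inj : injective (@letters n).
  move=> a b e; apply/permP => i.
  by have/eq_in_map/(_ i) := e; apply; rewrite mem_enum.
apply: uniq_perm => [||w]; rewrite ?permutations_uniq ?map_inj_uniq -?enumT ?enum_uniq //.
apply/set_wordsP/mapP => [[uw mw]|[a _ ->]]; last first.
  by split=> [|x]; rewrite ?letters_uniq // mem_letters inE.
have sw : size w = n by rewrite -(card_uniqP uw) (eq_card mw) cardsT card_ord.
pose tw := Tuple (introT eqP sw).
have tw_inj : injective (tnth tw) by apply/tuple_uniqP.
exists (perm tw_inj); rewrite ?mem_enum //.
rewrite -[LHS]/(tval tw) -[in LHS](map_tnth_enum tw).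
by apply: eq_map => i; rewrite permE.
Qed.

End JoinOfWords.

(** * Collecting the coefficient of each word *)

Lemma cut_sign_wcomp (R : pzRingType) n (a b c : 'S_n) :
  cut_sign (letter_rank (eps n)) (letter_rank a) R (letters b) (letters (wcomp b c)) =
  if d_cond a c b then (-1) ^+ size (wjoin (eps n) c) else 0.
Proof.
rewrite /cut_sign size_letters prod_cut_factorE /index_iota subn0 -d_condE size_wjoin.
by rewrite (eq_count (agree_wcomp b c)).
Qed.

Theorem theorem4p9 (k : fieldType) (char_k : [pchar k] =i pred0)
  (S : {linear PR k -> PR k}) (hS : is_antipode S)
  (n : nat) (alpha : 'S_n) :
  S (bas k alpha) =
  \sum_(gamma : 'S_n)
     ((-1) ^+ size (wjoin (eps n) gamma) * (d_coef alpha gamma)%:R)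
       *: bas k gamma.
Proof.
have -> : bas k alpha = bid k (lo (st alpha setT)) by rewrite lo_st_setT.
rewrite (antipode_st alpha hS) (perm_big _ (set_words_setT n)) big_image /=.
have termE (b : 'S_n) : \sum_(d <- set_words [set: 'I_n])
    cut_sign (letter_rank (eps n)) (letter_rank alpha) k (letters b) d
      *: bid k (index_word (letters b) d) =
  \sum_(gamma : 'S_n) (if d_cond alpha gamma b
    then (-1) ^+ size (wjoin (eps n) gamma) else 0) *: bas k gamma.
  rewrite (perm_big _ (set_words_setT n)) big_image /=.
  (* For fixed [b], every word [d] is [b o gamma] for a unique [gamma], so the sum over [d] becomes
     a sum over [gamma]. *)
  have wcomp_inj : injective (wcomp b) by exact: mulIg.
  rewrite [LHS](reindex_inj wcomp_inj) /=.
  by apply: eq_bigr => c _; rewrite cut_sign_wcomp index_word_wcomp.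
rewrite (eq_bigr _ (fun b _ => termE b)) exchange_big; apply: eq_bigr => c _.
(* With [gamma] fixed the sign is constant in [beta], so the inner sum only counts the admissible
   [beta]. *)
rewrite -scaler_suml -big_mkcond sumr_const mulr_natr.
by congr (_ *+ _ *: _); apply: eq_card => b; rewrite inE.
Qed.
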